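(* Let $\Gamma=(V,E)$ be a connected simple graph of order $n$, minimum degree $\delta$ and maximum degree $\Delta$, let $\mu$ be the algebraic connectivity of $\Gamma$, and let $k\in\{-\Delta,\dots,\Delta\}$. Then $$\left\lceil\frac{n(k+\mu)-\mu}{n+\mu}\right\rceil\ \le\ \phi_k(\Gamma)\ \le\ \left\lfloor\frac{2n+k-\delta-1}{2}\right\rfloor .$$
   Context: For $S\subseteq V$ and $v\in V$, $\delta_S(v)$ denotes the number of neighbors of $v$ in $S$, and $\overline{S}=V\setminus S$. For an integer $k$, a nonempty set $S\subseteq V$ is a defensive $k$-alliance if $\delta_S(v)\ge\delta_{\overline{S}}(v)+k$ for every $v\in S$. A set $X\subseteq V$ is defensive $k$-alliance free ($k$-daf) if no subset of $X$ is a defensive $k$-alliance. $\phi_k(\Gamma)$ denotes the largest cardinality of a $k$-daf set in $\Gamma$. The algebraic connectivity of $\Gamma$ is the second smallest eigenvalue (counted with multiplicity) of the Laplacian matrix of $\Gamma$. *)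

(* Defs.v *)
From HB Require Import structures.
From mathcomp Require Import all_boot all_order all_algebra.
From mathcomp Require Import polyrcf.
From mathcomp Require Import reals.

Set Implicit Arguments.
Unset Strict Implicit.
Unset Printing Implicit Defensive.

Import Order.TTheory GRing.Theory Num.Theory.
Local Open Scope ring_scope.

Definition simple_graph (T : finType) (e : rel T) : Prop :=
  symmetric e /\ irreflexive e.

Definition connected_graph (T : finType) (e : rel T) : Prop :=
  (0 < #|T|)%N /\ forall x y : T, connect e x y.

Definition nb_in (T : finType) (e : rel T) (S : {set T}) (v : T) : nat :=
  #|[set u in S | e v u]|.

Definition deg (T : finType) (e : rel T) (v : T) : nat := nb_in e [set: T] v.

(* All degrees of a simple graph are below #|T|, so this value is neutral. *)
Definition min_deg (T : finType) (e : rel T) : nat :=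
  \big[minn/#|T|]_(v : T) deg e v.

Definition max_deg (T : finType) (e : rel T) : nat := (\max_(v : T) deg e v)%N.

Definition defensive_alliance (T : finType) (e : rel T) (k : int)
    (S : {set T}) : bool :=
  (S != set0) &&
  [forall v in S, (nb_in e (~: S) v)%:Z + k <= (nb_in e S v)%:Z].

Definition daf (T : finType) (e : rel T) (k : int) (X : {set T}) : bool :=
  [forall S : {set T}, (S \subset X) ==> ~~ defensive_alliance e k S].

(* The maximum ranges over a nonempty family: set0 is always k-daf. *)
Definition phi (T : finType) (e : rel T) (k : int) : nat :=
  (\max_(X : {set T} | daf e k X) #|X|)%N.

Definition laplacian (R : realType) (T : finType) (e : rel T) : 'M[R]_#|T| :=
  \matrix_(i, j) (if i == j then (deg e (enum_val i))%:R
                  else - (e (enum_val i) (enum_val j))%:R).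

(* rootsR lists the distinct real roots in increasing order, so this is the
   nondecreasing list of the real eigenvalues of A, each repeated according to
   its algebraic multiplicity.  For symmetric A it has length n. *)
Definition spectrum (R : realType) (n : nat) (A : 'M[R]_n) : seq R :=
  flatten [seq nseq (mup x (char_poly A)) x | x <- rootsR (char_poly A)].

(* Indices start at 0: entry 1 is the second smallest eigenvalue.  It is 0 by
   convention on a one-vertex graph, which has no second eigenvalue. *)
Definition algebraic_connectivity (R : realType) (T : finType) (e : rel T) : R :=
  nth 0 (spectrum (laplacian R e)) 1.

(* Main.v *)
Require Import Defs.
From mathcomp Require Import all_boot all_order all_algebra all_fingroup.
From mathcomp Require Import polyrcf complex.
From mathcomp Require Import reals.
From mathcomp Require Import ring lra zify.

(** The lower bound is a statement about defensive alliances: a largest k-daf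
    set is either the whole vertex set, or cannot be enlarged, so that adding
    one vertex to it creates a defensive k-alliance of at most phi + 1 vertices
    (phi_cases).  It is therefore enough to show that every defensive
    k-alliance S has at least n (k + mu + 1) / (n + mu) vertices
    (alliance_card_ge).

    This comes from counting the edges that leave S in two ways.  A vertex of S
    has at most |S| - 1 neighbours in S, so the alliance condition leaves it at
    most |S| - 1 - k neighbours outside.  On the other hand the Laplacian
    quadratic form, evaluated at the mean-zero function n 1_S - |S|, is n^2
    times the size of the edge cut, whence Fiedler's inequality
    mu |S| (n - |S|) <= n cut(S) (edge_cut_ge).

    Fiedler's inequality needs the variational meaning of mu: mu times the
    squared norm is below the Laplacian form on vectors orthogonal to the
    constants.  Since mu is defined as an entry of the sorted list of roots of
    the characteristic polynomial, this requires the spectral theorem: the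
    Laplacian is diagonalized by a unitary complex matrix
    (symmetric_diagonalization), the diagonal is, up to order, the list of roots
    (spectrum_roots), and all diagonal entries but one are at least mu.  If
    mu > 0, the constant vector, being in the kernel, lies on the remaining axis,
    so a vector orthogonal to it has no coordinate there
    (second_eigenvalue_rayleigh).  If mu = 0, positivity of the form is enough.

    The upper bound is combinatorial: a nonempty k-daf set X is not itself a
    defensive k-alliance, and a vertex v of X that witnesses this satisfies
    delta + 1 <= deg v + 1 <= 2 |V - X| + k (daf_card_le). *)

Set Implicit Arguments.
Unset Strict Implicit.
Unset Printing Implicit Defensive.

Import Order.TTheory GRing.Theory Num.Theory.
Local Open Scope ring_scope.
Local Open Scope sesquilinear_scope.

Local Notation toC := (map_mx (real_complex _)).
Local Notation C R := (complex R).

(** * Diagonalization of real symmetric matrices *)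

Lemma char_poly_conj (F : fieldType) n (P A : 'M[F]_n) :
  P \in unitmx -> char_poly (invmx P *m A *m P) = char_poly A.
Proof.
move=> Pu; set PX := map_mx (@polyC F) P.
have PXu : map_mx (@polyC F) (invmx P) *m PX = 1%:M.
  by rewrite -map_mxM mulVmx // map_mx1.
have -> : char_poly (invmx P *m A *m P) =
    \det (map_mx (@polyC F) (invmx P) *m char_poly_mx A *m PX).
  rewrite /char_poly /char_poly_mx mulmxBr mulmxBl !map_mxM /=.
  by rewrite scalar_mxC -(mulmxA 'X%:M) PXu mulmx1.
by rewrite !det_mulmx mulrAC -det_mulmx PXu det1 mul1r.
Qed.

(** The unitary matrix is complex because the spectral theorem is applied to A
    as a Hermitian matrix; its diagonal is real, so it can be given over R. *)
Lemma symmetric_diagonalization (R : realType) n (A : 'M[R]_n) :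
  A^T = A ->
  exists (U : 'M[C R]_n) (d : 'rV[R]_n),
    [/\ U \is unitarymx, toC A = U^t* *m diag_mx (toC d) *m U &
        char_poly A = \prod_i ('X - (d 0 i)%:P)].
Proof.
move=> Asym.
have herm : toC A \is hermsymmx.
  apply: realsym_hermsym.
    by apply/is_hermitianmxP; rewrite expr0 scale1r map_mx_id // map_trmx Asym.
  by apply/mxOverP => i j; rewrite mxE complex_real.
have /mxOverP dreal := hermitian_spectral_diag_real herm.
have Uu := spectral_unitarymx (toC A).
pose d := \row_i complex.Re (spectral_diag (toC A) 0 i).
have dE : spectral_diag (toC A) = toC d.
  by apply/rowP => i; rewrite !mxE RRe_real.
have /orthomx_spectralP AE := hermitian_normalmx herm.
exists (spectralmx (toC A)), d; split=> //.
  by rewrite -invmx_unitary // -dE.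
apply: (map_poly_inj (real_complex R)).
rewrite map_char_poly [toC A in LHS]AE char_poly_conj ?spectral_unit //.
rewrite char_poly_trig ?diag_mx_is_trig // rmorph_prod.
apply: eq_bigr => i _.
by rewrite mxE eqxx mulr1n dE mxE rmorphB /= map_polyX map_polyC.
Qed.

(** The row toC x *m U^t* lists the coordinates of x in the orthonormal basis
    formed by the rows of U. *)
Lemma diag_quadratic_form (R : realType) n (A : 'M[R]_n) (U : 'M[C R]_n)
    (d : 'rV[R]_n) (x : 'rV[R]_n) :
  toC A = U^t* *m diag_mx (toC d) *m U ->
  ((x *m A *m x^T) 0 0)%:C%C =
    \sum_i (d 0 i)%:C%C * `|(toC x *m U^t*) 0 i| ^+ 2.
Proof.
move=> AE; set y := toC x *m U^t*.
have yt : U *m toC x^T = y^t*.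
  rewrite /y trmx_mul map_mxM /= !map_trmx trmxK -!map_mx_comp.
  congr (_ *m _).
    by apply/matrixP => i j; rewrite !mxE /= conjCK.
  by apply/matrixP => i j; rewrite !mxE /= conj_Creal ?complex_real.
have -> : ((x *m A *m x^T) 0 0)%:C%C = (toC (x *m A *m x^T)) 0 0.
  by rewrite [RHS]mxE.
rewrite !map_mxM AE !mulmxA -/y -!mulmxA yt mulmxA mxE.
apply: eq_bigr => i _; rewrite -/y mul_diag_mx !mxE normCK mulrCA.
by rewrite mulrA.
Qed.

(** * The sorted list of eigenvalues *)

Lemma sorted_flatten_nseq (R : realType) (f : R -> nat) (r : seq R) :
  sorted <%R r -> sorted <=%R (flatten [seq nseq (f x) x | x <- r]).
Proof.
rewrite !sorted_pairwise ?pairwise_map; [|exact: le_trans|exact: lt_trans].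
elim: r => //= x r IH /andP[/allP xr /IH r_sorted].
rewrite pairwise_cat r_sorted andbT; apply/andP; split.
  apply/allrelP => a b /nseqP[-> _] /flatten_mapP[y yr /nseqP[-> _]].
  exact/ltW/xr.
by elim: (f x) => //= m ->; rewrite andbT all_nseq lexx orbT.
Qed.

(** Two lists with equal multiplicities are permutations of each other, and
    the multiplicity of x as a root of a product of linear factors is the number
    of factors 'X - x. *)
Lemma spectrum_roots (R : realType) n (A : 'M[R]_n) (s : seq R) :
  char_poly A = \prod_(a <- s) ('X - a%:P) ->
  perm_eq (spectrum A) s /\ sorted <=%R (spectrum A).
Proof.
move=> As; split; last exact/sorted_flatten_nseq/sorted_roots.
have p0 : char_poly A != 0 by rewrite monic_neq0 ?char_poly_monic.
apply/allP => x _ /=; apply/eqP.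
rewrite -[in RHS]mu_prod_XsubC -As /spectrum.
set p := char_poly A.
have -> : mup x p = if x \in rootsR p then mup x p else 0%N.
  have := roots_on_rootsR p0 x; rewrite in_itv /= -/p => <-.
  by case: (boolP (root p x)) => // /mupNroot.
have := uniq_roots (- cauchy_bound p) (cauchy_bound p) p.
rewrite -/(rootsR p); elim: (rootsR p) => //= a r IH /andP[ar /IH {}IH].
rewrite count_cat IH count_nseq /= in_cons eq_sym.
by case: eqVneq => [->|_]; rewrite /= ?(negbTE ar) ?mul1n ?addn0 ?mul0n.
Qed.

Lemma row_sqr_ge0 (R : realType) n (x : 'rV[R]_n) : 0 <= (x *m x^T) 0 0.
Proof. by rewrite mxE sumr_ge0 // => i _; rewrite mxE -expr2 sqr_ge0. Qed.

Lemma row_sqr_gt0 (R : realType) n (x : 'rV[R]_n) :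
  x != 0 -> 0 < (x *m x^T) 0 0.
Proof.
move=> x0; rewrite lt_def row_sqr_ge0 andbT; apply: contra_neq x0.
rewrite mxE => /psumr_eq0P x_eq0; apply/rowP => i.
have /eqP : x 0 i * x^T i 0 = 0.
  by apply: x_eq0 => // j _; rewrite mxE -expr2 sqr_ge0.
by rewrite !mxE mulf_eq0 orbb => /eqP.
Qed.

(** The form takes the value a |v|^2 at a left eigenvector v for a. *)
Lemma psd_char_poly_root_ge0 (R : realType) n (A : 'M[R]_n) a :
  (forall x : 'rV[R]_n, 0 <= (x *m A *m x^T) 0 0) ->
  root (char_poly A) a -> 0 <= a.
Proof.
move=> psd; rewrite -eigenvalue_root_char => /eigenvalueP[v vA v0].
by have := psd v; rewrite vA -scalemxAl mxE pmulr_lge0 // row_sqr_gt0.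
Qed.

(** The permutation that sorts d names the exceptional index: the one whose
    entry is sorted to the front. *)
Lemma all_but_one_ge_second (R : realType) n (d : 'rV[R]_n) (s : seq R) :
  perm_eq s [seq d 0 i | i <- enum 'I_n] -> sorted <=%R s -> (1 < n)%N ->
  exists i0, forall i, i != i0 -> nth 0 s 1 <= d 0 i.
Proof.
case: n d => [|[|n]] // d s_perm s_sorted _.
have /tuple_permP[p sE] : perm_eq s [tuple d 0 i | i < n.+2] by [].
have nthE i : (i < n.+2)%N -> nth 0 s i = d 0 (p (inord i)).
  by move=> lt_i; rewrite sE -[i in LHS](inordK lt_i) -tnth_nth !tnth_mktuple.
exists (p 0) => i; rewrite -[i in d 0 i](permKV p).
set j := (p^-1)%g i => ip0.
have j0 : (0 < j)%N.
  rewrite lt0n; apply: contra_neq ip0 => j0.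
  by rewrite -(permKV p i) -/j; congr (p _); apply: val_inj.
have -> : d 0 (p j) = nth 0 s j by rewrite nthE // inord_val.
have sz : size s = n.+2 by rewrite sE size_tuple.
by apply: sorted_leq_nth => //; rewrite ?inE ?sz //; apply: le_trans.
Qed.

(** The variational bound for the second eigenvalue, when a vector v of the
    kernel is known.  In the eigenbasis v is supported on the index i0 of the
    smallest eigenvalue, as the other eigenvalues are at least the second one,
    hence positive; so a vector orthogonal to v only sees eigenvalues that are
    at least the second one. *)
Lemma second_eigenvalue_rayleigh (R : realType) n (A : 'M[R]_n)
    (v x : 'rV[R]_n) :
  A^T = A -> (forall y : 'rV[R]_n, 0 <= (y *m A *m y^T) 0 0) ->
  v *m A = 0 -> v != 0 -> x *m v^T = 0 ->
  nth 0 (spectrum A) 1 * (x *m x^T) 0 0 <= (x *m A *m x^T) 0 0.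
Proof.
move=> Asym psd vA v0 xv.
have [U [d [Uu AE chA]]] := symmetric_diagonalization Asym.
have UU : U^t* *m U = 1%:M by apply/mulmx1C/unitarymxP.
have d_ge0 i : 0 <= d 0 i.
  apply: (psd_char_poly_root_ge0 psd).
  by rewrite chA rootE horner_prod (bigD1 i) //= hornerXsubC subrr mul0r.
have chA' : char_poly A = \prod_(a <- [seq d 0 i | i <- enum 'I_n]) ('X - a%:P).
  by rewrite big_map big_enum.
have [sp_perm sp_sorted] := spectrum_roots chA'.
set mu := nth 0 _ 1.
(* A nonpositive second eigenvalue, in particular the default value 0 when
   n <= 1, leaves only the positivity of the form to be used. *)
have [mu_gt0|mu_le0] := ltP 0 mu; last first.
  by apply: le_trans (psd x); apply: mulr_le0_ge0 => //; apply: row_sqr_ge0.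
have n_gt1 : (1 < n)%N.
  rewrite -[n](card_ord n) cardE -(size_map (d 0)) -(perm_size sp_perm) ltnNge.
  by apply/negP => sz; move: mu_gt0; rewrite /mu nth_default ?ltxx.
have [i0 d_ge] := all_but_one_ge_second sp_perm sp_sorted n_gt1.
rewrite -/mu in d_ge.
pose y := toC x *m U^t*; pose w := toC v *m U^t*.
have w0 i : i != i0 -> w 0 i = 0.
  move=> ii0; have : (w *m diag_mx (toC d)) 0 i = 0.
    have -> : w *m diag_mx (toC d) = toC (v *m A) *m U^t*.
      by rewrite map_mxM AE !mulmxA mulmxtVK.
    by rewrite vA map_mx0 mul0mx mxE.
  rewrite mul_mx_diag mxE => /eqP; rewrite mulf_eq0 => /orP[/eqP//|].
  rewrite mxE fmorph_eq0 => /eqP di0.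
  by have := lt_le_trans mu_gt0 (d_ge i ii0); rewrite di0 ltxx.
have wi0 : w 0 i0 != 0.
  apply: contra_neq v0 => wi0.
  have w00 : w = 0.
    by apply/rowP => i; rewrite [RHS]mxE; have [->|/w0] := eqVneq i i0.
  apply: (map_mx_inj (f := real_complex R)); rewrite map_mx0.
  by rewrite -[toC v]mulmx1 -UU mulmxA -/w w00 mul0mx.
have yi0 : y 0 i0 = 0.
  have : (y *m w^t*) 0 0 = 0.
    have -> : y *m w^t* = toC (x *m v^T).
      rewrite /w /y trmx_mul map_mxM /= !map_trmx trmxK -!map_mx_comp.
      rewrite map_mxM mulmxA; congr (_ *m _).
        rewrite (_ : U ^ _ = U) ?mulmxKtV //.
        by apply/matrixP => i j; rewrite !mxE /= conjCK.
      by apply/matrixP => i j; rewrite !mxE /= conj_Creal ?complex_real.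
    by rewrite xv map_mx0 mxE.
  have wtE i : (w^t*) i 0 = (w 0 i)^* by rewrite !mxE.
  rewrite mxE (bigD1 i0) //= big1 ?addr0 => [/eqP|i /w0 wi]; last first.
    by rewrite wtE wi conjC0 mulr0.
  by rewrite wtE mulf_eq0 conjC_eq0 (negbTE wi0) orbF => /eqP.
(* The squared norm is the form of the identity, diagonal in the same basis. *)
have oneE : toC 1%:M = U^t* *m diag_mx (toC (const_mx 1)) *m U.
  by rewrite map_mx1 map_const_mx rmorph1 diag_const_mx mulmx1 UU.
rewrite -lecR rmorphM /= (diag_quadratic_form x AE).
have -> : x *m x^T = x *m 1%:M *m x^T by rewrite mulmx1.
rewrite (diag_quadratic_form x oneE).
rewrite mulr_sumr; apply: ler_sum => i _; rewrite mxE mul1r -/y.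
have [->|ii0] := eqVneq i i0; first by rewrite yi0 normr0 expr0n !mulr0.
by rewrite ler_wpM2r ?exprn_ge0 // lecR d_ge.
Qed.

(** * Laplacian quadratic form *)

Definition row_of (R : realType) (T : finType) (f : T -> R) : 'rV[R]_#|T| :=
  \row_i f (enum_val i).

Lemma sum_enum_val (R : realType) (T : finType) (F : T -> R) :
  \sum_(i < #|T|) F (enum_val i) = \sum_u F u.
Proof. by rewrite [RHS](reindex _ (onW_bij _ (@enum_val_bij T))). Qed.

Lemma row_of_dot (R : realType) (T : finType) (f g : T -> R) :
  (row_of f *m (row_of g)^T) 0 0 = \sum_u f u * g u.
Proof.
rewrite mxE -(sum_enum_val (fun u => f u * g u)).
by apply: eq_bigr => i _; rewrite !mxE.
Qed.

Lemma row_of_entries (R : realType) (T : finType) (x : 'rV[R]_#|T|) :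
  x = row_of (fun u => x 0 (enum_rank u)).
Proof. by apply/rowP => i; rewrite mxE enum_valK. Qed.

Lemma nb_inE (T : finType) (e : rel T) (S : {set T}) v :
  nb_in e S v = (\sum_u (u \in S) * e v u)%N.
Proof.
rewrite /nb_in -sum1_card big_mkcond /=; apply: eq_bigr => u _.
by rewrite inE; case: (u \in S); case: (e v u).
Qed.

Lemma sum_edges_sym (R : realType) (T : finType) (e : rel T) (F : T -> T -> R) :
  symmetric e ->
  \sum_u \sum_v (e u v)%:R * F u v = \sum_u \sum_v (e u v)%:R * F v u.
Proof.
move=> e_sym; rewrite exchange_big /=; apply: eq_bigr => u _.
by apply: eq_bigr => v _; rewrite e_sym.
Qed.

Section Laplacian.
Variables (R : realType) (T : finType) (e : rel T).
Hypothesis e_simple : simple_graph e.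

Let L := laplacian R e.

Lemma laplacian_sym : L^T = L.
Proof.
case: e_simple => e_sym _; apply/matrixP => i j; rewrite !mxE eq_sym e_sym.
by case: eqP => [->|].
Qed.

Lemma row_of_laplacian (f : T -> R) :
  row_of f *m L = row_of (fun u => \sum_v (e u v)%:R * (f u - f v)).
Proof.
case: e_simple => e_sym e_irr; apply/rowP => j; rewrite !mxE.
set y := enum_val j.
under eq_bigr => i _ do rewrite !mxE -(inj_eq enum_val_inj) -/y e_sym.
rewrite (sum_enum_val (fun u =>
  f u * (if u == y then (deg e u)%:R else - (e y u)%:R))).
under [RHS]eq_bigr do rewrite mulrBr.
rewrite sumrB -mulr_suml.
have -> : \sum_v (e y v)%:R = (deg e y)%:R :> R.
  rewrite /deg nb_inE natr_sum; apply: eq_bigr => v _.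
  by rewrite in_setT mul1n.
rewrite (bigD1 y) //= eqxx [in RHS](bigD1 y) //= e_irr mul0r add0r mulrC.
congr (_ + _); rewrite -sumrN; apply: eq_bigr => u /negbTE ->.
by rewrite mulrN mulrC.
Qed.

Lemma laplacian_form (f : T -> R) :
  (row_of f *m L *m (row_of f)^T) 0 0 =
    \sum_u \sum_v (e u v)%:R * ((f u - f v) * f u).
Proof.
rewrite row_of_laplacian row_of_dot; apply: eq_bigr => u _.
by rewrite mulr_suml; apply: eq_bigr => v _; rewrite mulrA.
Qed.

(** Adding to the form its copy with the end points of each edge exchanged gives
    the sum of the (f u - f v)^2 over ordered edges. *)
Lemma laplacian_psd (x : 'rV[R]_#|T|) : 0 <= (x *m L *m x^T) 0 0.
Proof.
rewrite (row_of_entries x); set f := fun u => _; rewrite laplacian_form.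
rewrite -(pmulr_lge0 _ (ltr0Sn R 1)) mulr_natr mulr2n.
rewrite [X in _ + X](@sum_edges_sym _ _ _ (fun u v => (f u - f v) * f u));
  last by case: e_simple.
rewrite -big_split /=; apply: sumr_ge0 => u _.
rewrite -big_split /=; apply: sumr_ge0 => v _.
rewrite -mulrDr mulr_ge0 ?ler0n //.
by rewrite (_ : _ + _ = (f u - f v) ^+ 2) ?sqr_ge0 //; ring.
Qed.

Lemma algebraic_connectivity_ge0 : 0 <= algebraic_connectivity R e.
Proof.
rewrite /algebraic_connectivity; set s := spectrum _.
have [sz|sz] := ltnP 1 (size s); last by rewrite nth_default.
have : nth 0 s 1 \in s by exact: mem_nth.
case/flatten_mapP=> x xroot /nseqP[-> _].
apply: (psd_char_poly_root_ge0 laplacian_psd).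
have p0 : char_poly L != 0 by rewrite monic_neq0 ?char_poly_monic.
by have := roots_on_rootsR p0 x; rewrite xroot => /andP[].
Qed.

Lemma algebraic_connectivity_rayleigh (f : T -> R) :
  \sum_u f u = 0 ->
  algebraic_connectivity R e * (\sum_u f u ^+ 2) <=
    \sum_u \sum_v (e u v)%:R * ((f u - f v) * f u).
Proof.
move=> f0; have [T0|T_gt0] := posnP #|T|.
  rewrite !big_pred0 ?mulr0 // => u; by have := fintype0 u T0.
rewrite -laplacian_form.
have -> : \sum_u f u ^+ 2 = (row_of f *m (row_of f)^T) 0 0.
  by rewrite row_of_dot; apply: eq_bigr => u _.
apply: (@second_eigenvalue_rayleigh _ _ _ (row_of (fun _ => 1))).
- exact: laplacian_sym.
- exact: laplacian_psd.
- rewrite row_of_laplacian; apply/rowP => i; rewrite !mxE big1 // => v _.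
  by rewrite subrr mulr0.
- apply/eqP => /rowP/(_ (Ordinal T_gt0)) /eqP.
  by rewrite !mxE oner_eq0.
- apply/matrixP => i j; rewrite !ord1 row_of_dot mxE -[RHS]f0.
  by apply: eq_bigr => u _; rewrite mulr1.
Qed.

(** Fiedler's bound on an edge cut, from the Rayleigh bound at the function
    n 1_S - |S|, the multiple of the centred indicator of S that has no
    denominators.  Its squared norm is n |S| (n - |S|). *)
Lemma edge_cut_ge (S : {set T}) :
  algebraic_connectivity R e * (#|S|%:R * (#|T|%:R - #|S|%:R)) <=
    #|T|%:R * \sum_(v in S) (nb_in e (~: S) v)%:R.
Proof.
have [T0|T_gt0] := posnP #|T|.
  have -> : #|S| = 0%N by apply/eqP; rewrite -leqn0 -T0 max_card.
  by rewrite T0 !mul0r mulr0.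
set n : R := #|T|%:R; set s : R := #|S|%:R; set mu := algebraic_connectivity _ _.
pose a u : R := (u \in S)%:R.
have sum_a : \sum_u a u = s.
  rewrite /s -sum1_card natr_sum [RHS]big_mkcond.
  by apply: eq_bigr => u _; rewrite /a; case: ifP.
have sum_c (c : R) : \sum_(u : T) c = n * c by rewrite sumr_const mulr_natl.
have n_gt0 : 0 < n by rewrite ltr0n.
pose f u := n * a u - s.
have f0 : \sum_u f u = 0 by rewrite sumrB -mulr_sumr sum_a sum_c subrr.
rewrite -(ler_pM2r n_gt0).
apply: le_trans (_ : \sum_u \sum_v (e u v)%:R * ((f u - f v) * f u) <= _).
  apply: le_trans (algebraic_connectivity_rayleigh f0).
  rewrite (_ : \sum_u f u ^+ 2 = s * (n - s) * n) ?mulrA //.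
  have a2 u : a u ^+ 2 = a u by rewrite /a; case: (u \in S); rewrite ?expr1n ?expr0n.
  have -> : \sum_u f u ^+ 2 = \sum_u (a u * (n ^+ 2 - 2 * n * s) + s ^+ 2).
    by apply: eq_bigr => u _; rewrite /f sqrrB exprMn a2; ring.
  by rewrite big_split /= -mulr_suml sum_a sum_c; ring.
pose g u v : R := a u - a v.
have -> : \sum_u \sum_v (e u v)%:R * ((f u - f v) * f u) =
    n ^+ 2 * (\sum_u \sum_v (e u v)%:R * (g u v * a u))
    - n * s * (\sum_u \sum_v (e u v)%:R * g u v).
  rewrite !mulr_sumr -sumrB; apply: eq_bigr => u _.
  rewrite !mulr_sumr -sumrB; apply: eq_bigr => v _.
  by rewrite /f /g; ring.
(* The differences along an edge and along its reverse cancel, so subtracting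
   the constant |S| does not change the form. *)
have -> : \sum_u \sum_v (e u v)%:R * g u v = 0.
  have eN : \sum_u \sum_v (e u v)%:R * g u v = - \sum_u \sum_v (e u v)%:R * g u v.
    rewrite {1}(sum_edges_sym g); last by case: e_simple.
    rewrite -sumrN; apply: eq_bigr => u _; rewrite -sumrN; apply: eq_bigr => v _.
    by rewrite -mulrN /g opprB.
  lra.
have -> (c : R) : n * c * n = n ^+ 2 * c by ring.
rewrite mulr0 subr0.
rewrite ler_wpM2l ?sqr_ge0 // big_mkcond /= [leRHS]big_mkcond /=.
apply: ler_sum => u _; rewrite nb_inE natr_sum.
case: ifP => uS; last by rewrite big1 // => v _; rewrite /a uS !mulr0.
apply: ler_sum => v _; rewrite /g /a uS inE mulr1.
by case: (v \in S); case: (e u v); rewrite ?subrr ?mulr0 ?mul0r ?subr0 ?mulr1.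
Qed.

End Laplacian.

(** * Alliances and alliance-free sets *)

Section Alliances.
Variables (T : finType) (e : rel T) (k : int).

Lemma nb_in_le_card (S : {set T}) v : (nb_in e S v <= #|S|)%N.
Proof. by apply/subset_leq_card/subsetP => u; rewrite inE => /andP[]. Qed.

Lemma deg_split (S : {set T}) v : deg e v = (nb_in e S v + nb_in e (~: S) v)%N.
Proof.
rewrite /deg !nb_inE -big_split; apply: eq_bigr => u _ /=.
by rewrite !inE; case: (u \in S); rewrite ?addn0.
Qed.

Lemma min_deg_le v : (min_deg e <= deg e v)%N.
Proof.
rewrite /min_deg; elim: (index_enum T) (mem_index_enum v) => // u r IH.
rewrite in_cons big_cons geq_min => /predU1P[->|/IH ->]; first by rewrite leqnn.
by rewrite orbT.
Qed.

Lemma irreflexive_nb_in_lt (S : {set T}) v :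
  irreflexive e -> v \in S -> (nb_in e S v < #|S|)%N.
Proof.
move=> e_irr vS; rewrite (cardsD1 v S) vS add1n ltnS.
apply/subset_leq_card/subsetP => u; rewrite !inE => /andP[-> evu].
by rewrite andbT; apply: contraTneq evu => ->; rewrite e_irr.
Qed.

Lemma max_deg_lt : irreflexive e -> (0 < #|T|)%N -> (max_deg e < #|T|)%N.
Proof.
move=> e_irr T0; rewrite -(prednK T0) ltnS; apply/bigmax_leqP => v _.
by rewrite -ltnS prednK // -cardsT irreflexive_nb_in_lt.
Qed.

Lemma daf_set0 : daf e k set0.
Proof.
apply/forallP => S; apply/implyP; rewrite subset0 => /eqP->.
by rewrite /defensive_alliance eqxx.
Qed.

Lemma phi_attained : exists2 X, daf e k X & #|X| = phi e k.
Proof.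
have [|X dX phiE] := @eq_bigmax_cond _ (daf e k) (fun X => #|X|).
  by apply/card_gt0P; exists set0; apply: daf_set0.
by exists X.
Qed.

(** Maximality of a largest k-daf set X: unless X contains every vertex, an
    additional vertex creates an alliance inside a set of phi + 1 vertices. *)
Lemma phi_cases :
  phi e k = #|T| \/ exists2 S, defensive_alliance e k S & (#|S| <= (phi e k).+1)%N.
Proof.
have [X dX cX] := phi_attained.
have [XT|] := eqVneq X setT; first by left; rewrite -cX XT cardsT.
rewrite -subTset => /subsetPn[v _ vX]; right.
have : ~~ daf e k (v |: X).
  apply/negP => dvX; have : (#|v |: X| <= phi e k)%N.
    exact: (leq_bigmax_cond (F := fun X : {set T} => #|X|)).
  by rewrite cardsU1 vX cX ltnn.
case/forallPn => S; rewrite negb_imply negbK => /andP[sS dS]; exists S => //.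
by rewrite -cX -add1n -[1%N]/(nat_of_bool true) -vX -cardsU1 subset_leq_card.
Qed.

(** X is not an alliance, so some v in X has at most |V - X| + k - 1
    neighbours in X, besides at most |V - X| outside. *)
Lemma daf_card_le (X : {set T}) :
  X != set0 -> daf e k X ->
  (2 * #|X| + min_deg e + 1)%N%:Z <= (2 * #|T|)%N%:Z + k.
Proof.
move=> X0 /forallP/(_ X); rewrite subxx /defensive_alliance X0 /=.
case/forallPn => v; rewrite negb_imply -ltNge => /andP[vX viol].
have {viol} : (nb_in e X v)%:Z < (nb_in e (~: X) v)%:Z + k := viol.
have := min_deg_le v; rewrite (deg_split X).
have := nb_in_le_card (~: X) v; rewrite -(cardsC X).
move: #|X| #|~: X| => x y; lia.
Qed.

End Alliances.

(** Fiedler's bound on the cut of S, against the at most |S| - 1 - k edges that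
    leave S at each of its vertices; a factor |S| cancels. *)
Lemma alliance_card_ge (R : realType) (T : finType) (e : rel T) (k : int)
    (S : {set T}) (n := #|T|%:R : R) (mu := algebraic_connectivity R e) :
  simple_graph e -> defensive_alliance e k S ->
  n * (k%:~R + mu + 1) <= #|S|%:R * (n + mu).
Proof.
move=> e_simple /andP[S0 /forall_inP S_def].
have s_gt0 : (0 : R) < #|S|%:R by rewrite ltr0n card_gt0.
have cut_le : \sum_(v in S) (nb_in e (~: S) v)%:R <=
    #|S|%:R * (#|S|%:R - 1 - k%:~R) :> R.
  rewrite mulr_natl -sumr_const; apply: ler_sum => v vS.
  have := irreflexive_nb_in_lt (proj2 e_simple) vS; have := S_def v vS.
  set a := nb_in e (~: S) v; set b := nb_in e S v => le_ab lt_b.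
  have : a%:Z + 1 + k <= #|S|%:Z by lia.
  by rewrite -(ler_int R) !intrD -!pmulrn; lra.
have n_ge0 : 0 <= n by rewrite ler0n.
have := le_trans (edge_cut_ge R e_simple S) (ler_wpM2l n_ge0 cut_le).
rewrite -/n -/mu mulrCA [X in _ <= X]mulrCA ler_pM2l //.
by lra.
Qed.

Theorem theorem19 (R : realType) (T : finType) (e : rel T) (k : int)
    (e_simple : simple_graph e) (e_conn : connected_graph e)
    (k_range : - (max_deg e)%:Z <= k <= (max_deg e)%:Z) :
  let n : R := #|T|%:R in
  let mu : R := algebraic_connectivity R e in
  Num.ceil ((n * (k%:~R + mu) - mu) / (n + mu)) <= (phi e k)%:Z /\
  (phi e k)%:Z <=
    Num.floor ((2 * n + k%:~R - (min_deg e)%:R - 1) / 2 : R).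
Proof.
move=> n mu; have [T_gt0 _] := e_conn.
have max_lt := max_deg_lt (proj2 e_simple) T_gt0.
have mu_ge0 : 0 <= mu := algebraic_connectivity_ge0 R e_simple.
have n_gt0 : 0 < n by rewrite ltr0n.
split.
  rewrite ceil_le_int ler_pdivrMr ?ltr_wpDr // -pmulrn.
  have [->|[S S_def S_le]] := phi_cases e k.
    have : k%:~R <= n by rewrite /n -[_%:R]/(#|T|%:Z%:~R) ler_int; lia.
    rewrite -/n => k_le.
    have := ler_wpM2l (ltW n_gt0) k_le; lra.
  have := alliance_card_ge R e_simple S_def; rewrite -/n -/mu => S_ge.
  have S_le' : #|S|%:R <= (phi e k)%:R + 1 :> R by rewrite natr1 ler_nat.
  have nmu : 0 <= n + mu by rewrite addr_ge0 // ltW.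
  have := le_trans S_ge (ler_wpM2r nmu S_le'); lra.
rewrite floor_ge_int ler_pdivlMr //.
suff : (2 * phi e k + min_deg e + 1)%N%:Z <= (2 * #|T|)%N%:Z + k.
  by rewrite -(ler_int R) [leRHS]intrD -!pmulrn !(natrM, natrD) -/n; lra.
have [X dX <-] := phi_attained e k.
have [->|X0] := eqVneq X set0; last exact: daf_card_le.
(* The empty set gives no vertex to use; the range of k and the bound on the
   degrees suffice. *)
have [v _] := card_gt0P T_gt0.
have : (min_deg e <= max_deg e)%N.
  exact: leq_trans (min_deg_le e v) (leq_bigmax v).
by rewrite cards0; lia.
Qed.
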